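(* Let $n\ge 3$ and let $g=\sum_{i=1}^n dx_i^2$ be the Euclidean metric on $\mathbb{R}^n$ with coordinates $x=(x_1,\dots,x_n)$. Let $f_1,\dots,f_n:\mathbb{R}^n\to\mathbb{R}$ be smooth functions such that $3f_i(x)+f_j(x)\neq 0$ for all $x\in\mathbb{R}^n$ and all $i\neq j$. Put $T=\sum_{i=1}^n f_i\,dx_i^2$ and $R=T\odot g$. Fix an index $m\in\{1,\dots,n\}$. Then there exists a positive smooth function $\varphi$ on $\mathbb{R}^n$ such that the metric $\bar g=\frac{1}{\varphi^2}g$ has Riemannian curvature tensor $\bar R=R$ if and only if the functions $f_i$ satisfy the following system on $\mathbb{R}^n$: (1) $\displaystyle \frac{f_{i,x_j}}{3f_i+f_j}=\frac{f_{k,x_j}}{3f_k+f_j}$ for all $i\neq j$, $k\neq j$; (2) $\displaystyle \left(\frac{f_{j,x_i}}{3f_j+f_i}\right)_{,x_k}=\left(\frac{f_{j,x_k}}{3f_j+f_k}\right)_{,x_i}$ for all $i\neq j$, $k\neq j$; (3) $\displaystyle \left(\frac{f_{i,x_j}}{3f_i+f_j}\right)_{,x_i}=\left(\frac{f_{j,x_i}}{3f_j+f_i}\right)_{,x_j}$ for all $i\neq j$; (4) $\displaystyle \frac12\left(\frac{f_{j,x_i}}{3f_j+f_i}\right)^2-\left(\frac{f_{j,x_i}}{3f_j+f_i}\right)_{,x_i}-\frac12\sum_{k\neq i}\left(\frac{f_{\ell(k),x_k}}{3f_{\ell(k)}+f_k}\right)^2=h_i$ for all $i\neq j$, where for each $k$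 the index $\ell(k)$ is any index different from $k$ (by (1) the quotient does not depend on its choice); (5) $\displaystyle \frac{f_{j,x_i}}{3f_j+f_i}\cdot\frac{f_{i,x_j}}{3f_i+f_j}=\left(\frac{f_{i,x_j}}{3f_i+f_j}\right)_{,x_i}$ for all $i\neq j$; where $$h_i=f_i\,\exp\left(2\left(-\int\frac{f_{l,x_m}}{3f_l+f_m}\,dx_m+\psi\right)\right)$$ with $l$ any index different from $m$, and $\psi$ is some smooth function on $\mathbb{R}^n$ that does not depend on $x_m$ and satisfies the $n-1$ equations $$\psi_{,x_i}=\int\left(\frac{f_{i,x_m}}{3f_i+f_m}\right)_{,x_i}dx_m-\frac{f_{m,x_i}}{3f_m+f_i},\qquad i\neq m.$$ In that case, up to a multiplicative constant, $$\varphi(x)=\exp\left(-\int\frac{f_{l,x_m}}{3f_l+f_m}\,dx_m+\psi\right),\qquad l\neq m.$$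
   Context: Notation: $f_{i,x_j}$ and $(\cdot)_{,x_k}$ denote partial derivatives with respect to $x_j$, $x_k$. For symmetric $(0,2)$-tensors $h,k$ the Kulkarni–Nomizu product is $(h\odot k)(X,Y,Z,W)=h(X,Z)k(Y,W)+h(Y,W)k(X,Z)-h(X,W)k(Y,Z)-h(Y,Z)k(X,W)$. The Riemannian curvature $(0,4)$-tensor of a metric is taken with the sign convention for which a metric $\tilde g$ of constant sectional curvature $c$ has curvature tensor $\frac{c}{2}\,\tilde g\odot\tilde g$; equivalently $R_{\tilde g}=W_{\tilde g}+A_{\tilde g}\odot \tilde g$, where $W_{\tilde g}$ is the Weyl tensor and $A_{\tilde g}=\frac{1}{n-2}\left(\mathrm{Ric}_{\tilde g}-\frac{K_{\tilde g}}{2(n-1)}\tilde g\right)$ is the Schouten tensor, $K_{\tilde g}$ being the scalar curvature. The indefinite integral $\int(\cdot)\,dx_m$ denotes one fixed smooth function $P$ on $\mathbb{R}^n$ with $P_{,x_m}=\frac{f_{l,x_m}}{3f_l+f_m}$ (the same $P$ wherever it appears), and $\int\left(\frac{f_{i,x_m}}{3f_i+f_m}\right)_{,x_i}dx_m$ denotes $P_{,x_i}$. *)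

(* Defs.v *)
From mathcomp Require Export all_boot all_order all_algebra.
From mathcomp Require Export all_classical all_reals all_analysis.

Set Implicit Arguments.
Unset Strict Implicit.
Unset Printing Implicit Defensive.

Export Order.TTheory GRing.Theory Num.Theory.
Export numFieldNormedType.Exports.

#[global] Open Scope ring_scope.

Section Definitions.
Context {R : realType} {n : nat}.

Local Notation E := ('rV[R]_n).

Definition pd (i : 'I_n) (F : E -> R) : E -> R :=
  fun x => 'D_('e_i) F x.

Definition smooth (F : E -> R) : Prop :=
  forall s : seq 'I_n,
    continuous (foldr pd F s) /\
    forall (i : 'I_n) (x : E), derivable (foldr pd F s) x 'e_i.

(* Tensor fields are given by their components in the coordinate frame
   d/dx_1, ..., d/dx_n: a (0,2)-tensor field is a map E -> 'M[R]_n, a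
   (0,4)-tensor at a point is a map 'I_n -> 'I_n -> 'I_n -> 'I_n -> R. *)

Definition kulkarni_nomizu (h k : 'M[R]_n) (a b c d : 'I_n) : R :=
  h a c * k b d + h b d * k a c - h a d * k b c - h b c * k a d.

(* christoffel G k i j x is the symbol with upper index k and lower indices
   i, j. *)
Definition christoffel (G : E -> 'M[R]_n) (k i j : 'I_n) : E -> R := fun x =>
  2^-1 * \sum_(p < n) invmx (G x) k p *
    (pd i (fun y => G y j p) x + pd j (fun y => G y i p) x
     - pd p (fun y => G y i j) x).

(* The p-th component of R(d_i, d_j) d_l, where
   R(X, Y) = nabla_X nabla_Y - nabla_Y nabla_X - nabla_[X, Y]. *)
Definition curvature_endo (G : E -> 'M[R]_n) (i j l p : 'I_n) : E -> R :=
  fun x =>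
  pd i (christoffel G p j l) x - pd j (christoffel G p i l) x
  + \sum_(q < n) (christoffel G p i q x * christoffel G q j l x
                  - christoffel G p j q x * christoffel G q i l x).

(* R(X, Y, Z, W) = G(R(X, Y) W, Z): with this sign, constant sectional
   curvature c gives the tensor (c / 2) (G kulkarni_nomizu G). *)
Definition riemann (G : E -> 'M[R]_n) (x : E) (a b c d : 'I_n) : R :=
  \sum_(p < n) G x c p * curvature_endo G a b d p x.

Definition euclidean : E -> 'M[R]_n := fun=> 1%:M.

Definition conformal (phi : E -> R) : E -> 'M[R]_n :=
  fun x => (1 / phi x ^+ 2) *: euclidean x.

Definition diag_tensor (f : 'I_n -> E -> R) : E -> 'M[R]_n :=
  fun x => diag_mx (\row_i f i x).

Definition conformal_solution (f : 'I_n -> E -> R) (phi : E -> R) : Prop :=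
  [/\ smooth phi, (forall x, 0 < phi x) &
      forall x a b c d,
        riemann (conformal phi) x a b c d =
        kulkarni_nomizu (diag_tensor f x) (euclidean x) a b c d].

(* quo f i j is f_{i,x_j} / (3 f_i + f_j). *)
Definition quo (f : 'I_n -> E -> R) (i j : 'I_n) : E -> R :=
  fun x => pd j (f i) x / (3 * f i x + f j x).

Definition depends_not_on (m : 'I_n) (psi : E -> R) : Prop :=
  forall x y : E, (forall i, i != m -> x 0 i = y 0 i) -> psi x = psi y.

(* P stands for the fixed antiderivative with respect to x_m. *)
Definition psi_condition (f : 'I_n -> E -> R) (m : 'I_n) (P psi : E -> R) :
    Prop :=
  [/\ smooth psi, depends_not_on m psi &
      forall i, i != m -> forall x, pd i psi x = pd i P x - quo f m i x].

Definition phi_of (P psi : E -> R) : E -> R := fun x => expR (- P x + psi x).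

Definition h_of (f : 'I_n -> E -> R) (P psi : E -> R) (i : 'I_n) : E -> R :=
  fun x => f i x * expR (2 * (- P x + psi x)).

Definition pde_system (f h : 'I_n -> E -> R) : Prop :=
  [/\ forall i j k, i != j -> k != j -> forall x, quo f i j x = quo f k j x,
      forall i j k, i != j -> k != j ->
        forall x, pd k (quo f j i) x = pd i (quo f j k) x,
      forall i j, i != j -> forall x, pd i (quo f i j) x = pd j (quo f j i) x,
      forall ell : 'I_n -> 'I_n, (forall k, ell k != k) ->
        forall i j, i != j -> forall x,
        1 / 2 * quo f j i x ^+ 2 - pd i (quo f j i) x
        - 1 / 2 * \sum_(k < n | k != i) quo f (ell k) k x ^+ 2 = h i x
    & forall i j, i != j ->
        forall x, quo f j i x * quo f i j x = pd i (quo f i j) x].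

End Definitions.

(* Main.v *)
Require Import Defs.
From mathcomp Require Import ring lra.

Set Implicit Arguments.
Unset Strict Implicit.
Unset Printing Implicit Defensive.

(* With v_i = phi_{,i} / phi, the curvature of phi^{-2} g is phi^{-2} (S kn g),
   where S_ij = v_{j,i} + v_i v_j - |v|^2 delta_ij / 2 = phi_{,ij} / phi
   - |v|^2 delta_ij / 2.  As n >= 3, the equation R = T kn g therefore means
   S = phi^2 T, that is, phi_{,ij} = 0 for i != j and S_ii = phi^2 f_i.
   Differentiating phi phi_{,ii} - |grad phi|^2 / 2 = phi^4 f_i along x_j and
   eliminating phi_{,ii} - phi_{,jj} = phi^3 (f_i - f_j) gives
   v_j = - f_{i,j} / (3 f_i + f_j); with these values of v, equations (4) and (5)
   are S = phi^2 T, and psi = P + ln phi. *)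

(** * Calculus of directional derivatives of real functions *)

Section DirectionalDerivative.
Context {R : realType} {V : normedModType R}.
Implicit Types (F G : V -> R) (x v : V).

(** Both sides have the same difference quotient. This transfers the one-variable chain rule and the
    zero-derivative criterion to lines in [V]. *)
Lemma is_derive_lineP F x v (t d : R) :
  is_derive (t *: v + x) v F d <-> is_derive t 1 (fun h => F (h *: v + x)) d.
Proof.
have E : (fun h : R => h^-1 *: ((F \o shift (t *: v + x)) (h *: v) - F (t *: v + x)))
  = (fun h : R => h^-1 *: (((fun h => F (h *: v + x)) \o shift t) (h *: 1)
       - F (t *: v + x))).
  by apply/funext => h /=; rewrite addrA -scalerDl [h *: 1]mulr1.
split=> -[D1 D2]; (split; [move: D1 | move: D2]); by rewrite /derivable /derive E.
Qed.

Lemma is_derive_comp1 F x v (g : R -> R) (d d' : R) :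
  is_derive x v F d -> is_derive (F x) 1 g d' ->
  is_derive x v (fun y => g (F y)) (d' * d).
Proof.
move=> dF dg; rewrite -[x]add0r -(scale0r v); apply/is_derive_lineP.
have dF' : is_derive (0 : R) 1 (fun h : R => F (h *: v + x)) d.
  by apply/is_derive_lineP; rewrite scale0r add0r.
have dg' : is_derive (F ((0 : R) *: v + x)) 1 g d' by rewrite scale0r add0r.
exact: is_derive1_comp.
Qed.

Lemma is_derive_val F x v d : is_derive x v F d -> 'D_v F x = d.
Proof. by case. Qed.

Lemma is_derive_mulf F G x v d d' :
  is_derive x v F d -> is_derive x v G d' ->
  is_derive x v (fun y => F y * G y) (F x * d' + G x * d).
Proof. by move=> dF dG; have := is_deriveM dF dG. Qed.

Lemma is_derive_addf F G x v d d' :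
  is_derive x v F d -> is_derive x v G d' ->
  is_derive x v (fun y => F y + G y) (d + d').
Proof. by move=> dF dG; have := is_deriveD dF dG. Qed.

Lemma is_derive_oppf F x v d :
  is_derive x v F d -> is_derive x v (fun y => - F y) (- d).
Proof. by move=> dF; have := is_deriveN dF. Qed.

Lemma is_derive_invf F x v d : is_derive x v F d -> F x != 0 ->
  is_derive x v (fun y => (F y)^-1) (- (F x) ^- 2 * d).
Proof.
move=> [D1 D2] F0; split; first exact: derivableV.
by have := deriveV F0 D1; rewrite D2 => ->.
Qed.

Lemma is_derive_sumf n (F : 'I_n -> V -> R) x v (d : 'I_n -> R) :
  (forall k, is_derive x v (F k) (d k)) ->
  is_derive x v (fun y => \sum_(k < n) F k y) (\sum_(k < n) d k).
Proof.
move=> dF; rewrite (_ : (fun y => _) = \sum_(k < n) F k); first exact: is_derive_sum.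
by apply/funext => y; rewrite fct_sumE.
Qed.

Lemma derive_eq0_line F v :
  (forall x, is_derive x v F 0) -> forall (t : R) x, F (t *: v + x) = F x.
Proof.
move=> dF t x.
have := @is_derive_0_is_cst R (fun h => F (h *: v + x)) t 0.
rewrite scale0r add0r; apply=> h; exact/is_derive_lineP.
Qed.

End DirectionalDerivative.

(** * Smooth functions on R^n and vanishing partial derivatives *)

Section PartialDerivatives.
Context {R : realType} {n : nat}.
Local Notation E := ('rV[R]_n).
Implicit Types (F G : E -> R) (i j k : 'I_n).

Lemma smooth_is_derive F i x : smooth F -> is_derive x 'e_i F (pd i F x).
Proof. by move=> sF; apply: derivableP; case: (sF [::]) => _; apply. Qed.

Lemma smooth_pd F i : smooth F -> smooth (pd i F).
(* [foldr] applies the last index of the list first, so appending [i] differentiates along e_i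
   before everything else. *)
Proof. by move=> sF s; have := sF (rcons s i); rewrite foldr_rcons. Qed.

Lemma smooth_continuous F : smooth F -> continuous F.
Proof. by move=> /(_ [::])[]. Qed.

(* The closure of the smooth functions under the operations below is stable
   under partial derivatives, so all of it is smooth. *)
Inductive smooth_closure : (E -> R) -> Prop :=
| SmoothBase F : smooth F -> smooth_closure F
| SmoothAdd F G : smooth_closure F -> smooth_closure G ->
    smooth_closure (fun x => F x + G x)
| SmoothMul F G : smooth_closure F -> smooth_closure G ->
    smooth_closure (fun x => F x * G x)
| SmoothOpp F : smooth_closure F -> smooth_closure (fun x => - F x)
| SmoothInv F : smooth_closure F -> (forall x, F x != 0) ->
    smooth_closure (fun x => (F x)^-1)
| SmoothExp F : smooth_closure F -> smooth_closure (fun x => expR (F x))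
| SmoothLn F : smooth_closure F -> (forall x, 0 < F x) ->
    smooth_closure (fun x => ln (F x)).

Lemma smooth_closure_continuous F : smooth_closure F -> continuous F.
Proof.
elim=> {F} [F sF|F G _ cF _ cG|F G _ cF _ cG|F _ cF|F _ cF F0|F _ cF|F _ cF F0] x.
- exact: smooth_continuous.
- exact: (continuousD (cF x) (cG x)).
- exact: (continuousM (cF x) (cG x)).
- exact: (continuousN (cF x)).
- exact: (continuousV (F0 x) (cF x)).
- by apply: continuous_comp; [exact: cF|exact: continuous_expR].
- by apply: continuous_comp; [exact: cF|exact: continuous_ln].
Qed.

Lemma smooth_closure_pd i F : smooth_closure F ->
  exists2 G, smooth_closure G & forall x, is_derive x 'e_i F (G x).
Proof.
elim=> {F} [F sF|F G _ [F' sF' dF] _ [G' sG' dG]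
  |F G sF [F' sF' dF] sG [G' sG' dG]|F _ [F' sF' dF]
  |F sF [F' sF' dF] F0|F sF [F' sF' dF]|F sF [F' sF' dF] F0].
- exists (pd i F); first exact/SmoothBase/smooth_pd.
  by move=> x; apply: smooth_is_derive.
- exists (fun x => F' x + G' x); first exact: SmoothAdd.
  by move=> x; apply: is_derive_addf.
- exists (fun x => F x * G' x + G x * F' x).
    by apply: SmoothAdd; apply: SmoothMul.
  by move=> x; apply: is_derive_mulf.
- exists (fun x => - F' x); first exact: SmoothOpp.
  by move=> x; apply: is_derive_oppf.
- exists (fun x => - ((F x)^-1 * (F x)^-1) * F' x).
    by apply: SmoothMul => //; apply: SmoothOpp; apply: SmoothMul; apply: SmoothInv.
  move=> x; have := is_derive_invf (dF x) (F0 x).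
  by rewrite expr2 invfM.
- exists (fun x => expR (F x) * F' x).
    by apply: SmoothMul => //; apply: SmoothExp.
  by move=> x; apply: is_derive_comp1.
- exists (fun x => (F x)^-1 * F' x).
    by apply: SmoothMul => //; apply: SmoothInv => // x; rewrite gt_eqF.
  by move=> x; apply: is_derive_comp1; apply: is_derive1_ln.
Qed.

Lemma smooth_closure_smooth F : smooth_closure F -> smooth F.
Proof.
move=> sF s; suff sS : smooth_closure (foldr pd F s).
  split; first exact: smooth_closure_continuous.
  by move=> i x; have [G _ dG] := smooth_closure_pd i sS; case: (dG x).
elim: s => //= i s /(smooth_closure_pd i)[G sG dG].
by rewrite (_ : pd i _ = G)//; apply/funext => x; case: (dG x).
Qed.

Lemma pd_eq0_line F i : smooth F -> (forall x, pd i F x = 0) ->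
  forall (t : R) x, F (t *: 'e_i + x) = F x.
Proof.
move=> sF dF; apply: derive_eq0_line => x; rewrite -(dF x).
exact: smooth_is_derive.
Qed.

Lemma pd_eq0_depends_not_on F i : smooth F -> (forall x, pd i F x = 0) ->
  depends_not_on i F.
Proof.
(* Points that agree off coordinate [i] lie on a common line parallel to e_i, at parameter distance
   [y 0 i - x 0 i]. *)
move=> sF dF x y xy; rewrite -(pd_eq0_line sF dF (y 0 i - x 0 i) x).
congr F; apply/rowP => k; rewrite !mxE eqxx/=.
by have [->|/xy->] := eqVneq k i; rewrite ?mulr1 ?mulr0 ?subrK ?add0r.
Qed.

Lemma depends_not_on_pd F i x : depends_not_on i F -> pd i F x = 0.
Proof.
move=> dF; apply: is_derive_val; rewrite -[x]add0r -(scale0r 'e_i).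
apply/is_derive_lineP; rewrite (_ : (fun h => _) = cst (F x)).
  exact: is_derive_cst.
apply/funext => h /=; apply: dF => k ki.
by rewrite !mxE eqxx (negPf ki) mulr0 add0r.
Qed.

Lemma pd_eq0_cst F : smooth F -> (forall i x, pd i F x = 0) ->
  forall x y, F x = F y.
Proof.
move=> sF dF x y.
(* Walk from [x] to [y] by replacing one coordinate at a time; each step moves along a single
   axis. *)
pose z (s : seq 'I_n) := \row_k (if k \in s then y 0 k else x 0 k) : E.
have Fz s : F (z s) = F x.
  elim: s => [|i s <-]; first by congr F; apply/rowP => k; rewrite mxE.
  apply: (pd_eq0_depends_not_on sF (dF i)) => k ki.
  by rewrite !mxE in_cons (negPf ki).
rewrite -(Fz (enum 'I_n)); congr F; apply/rowP => k.
by rewrite mxE mem_enum.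
Qed.

(* Since F is constant along e_j, so are its derivatives; this replaces
   Schwarz's theorem. *)
Lemma pd_pd_eq0 F i j : smooth F -> (forall x, pd j F x = 0) ->
  forall x, pd j (pd i F) x = 0.
Proof.
move=> sF dF x; apply: depends_not_on_pd => y z yz.
(* The vector [z - y] is a multiple of e_j, so translation by it preserves [F], hence also the
   difference quotients of [F] along e_i. *)
have tr (w : E) : F (z - y + w) = F w.
  apply: (pd_eq0_depends_not_on sF dF) => k kj.
  by rewrite !mxE yz// subrr add0r.
have tr0 : (fun h : R => F (h *: 'e_i + z)) = (fun h : R => F (h *: 'e_i + y)).
  apply/funext => h; rewrite -(tr (h *: 'e_i + y)); congr F.
  by rewrite addrCA subrK.
have := smooth_is_derive i (0 *: 'e_i + y) sF; move/is_derive_lineP; rewrite -tr0.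
by move/is_derive_lineP/is_derive_val; rewrite !scale0r !add0r.
Qed.

End PartialDerivatives.

(** * Contractions with Kronecker deltas *)

Section KroneckerSums.
Context {R : comPzRingType} {n : nat}.
Local Notation dl i j := ((i == j)%:R : R).

Lemma sum_delta (k : 'I_n) (F : 'I_n -> R) : \sum_(p < n) dl p k * F p = F k.
Proof.
rewrite (bigD1 k)//= eqxx mul1r big1 ?addr0// => p /negPf->.
by rewrite mul0r.
Qed.

(** The two factors are the Christoffel symbols of phi^{-2} g with upper index [c], lower [a], [q],
    and with upper index [q], lower [b], [d]; the sum is a quadratic term of the curvature. *)
Lemma sum_connection_products (v : 'I_n -> R) (a b c d : 'I_n) :
  \sum_(q < n) - (dl q c * v a + dl a c * v q - dl a q * v c) *
    - (dl d q * v b + dl b q * v d - dl b d * v q) =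
  dl d c * v a * v b + dl b c * v a * v d + 2 * dl a c * v b * v d
  - dl a d * v b * v c - dl a b * v c * v d
  - dl a c * dl b d * \sum_(q < n) v q ^+ 2.
Proof.
pose w q := dl d q * v b + dl b q * v d - dl b d * v q.
(* Group the product by the delta that contains [q]: each group collapses to one term, and the group
   without such a delta gives |v|^2. *)
rewrite (eq_bigr (fun q => dl q c * (v a * w q) + dl q a * (- v c * w q)
  + dl q d * (dl a c * v q * v b) + dl q b * (dl a c * v q * v d)
  + (- dl a c * dl b d) * v q ^+ 2)); last first.
  move=> q _; rewrite /w (eq_sym q a) (eq_sym q b) (eq_sym q d).
  move: (dl q c) (dl a q) (dl d q) (dl b q) (dl a c) (dl b d) => *; ring.
rewrite !big_split/= !sum_delta -mulr_sumr /w (eq_sym b a) (eq_sym d a).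
move: (dl d c) (dl b c) (dl a c) (dl a d) (dl a b) (dl b d) => *; ring.
Qed.

End KroneckerSums.

(** * Curvature of the conformally flat metric phi^{-2} g *)

Section ConformalCurvature.
Context {R : realType} {n : nat}.
Local Notation E := ('rV[R]_n).
Variable phi : E -> R.
Hypotheses (phi_smooth : smooth phi) (phi_gt0 : forall x, 0 < phi x).
Implicit Types (i j k : 'I_n) (x : E).

Local Notation dl i j := ((i == j)%:R : R).

Definition logder i x : R := pd i phi x / phi x.

Let phi_neq0 x : phi x != 0. Proof. by rewrite gt_eqF. Qed.

Let phi_derive i x : is_derive x 'e_i phi (pd i phi x).
Proof. exact: smooth_is_derive. Qed.

Lemma smooth_logder i : smooth (logder i).
Proof.
apply: smooth_closure_smooth; apply: SmoothMul.
  exact/SmoothBase/smooth_pd.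
exact/SmoothInv/phi_neq0/SmoothBase.
Qed.

Let logder_derive i j x : is_derive x 'e_i (logder j) (pd i (logder j) x).
Proof. exact/smooth_is_derive/smooth_logder. Qed.

Lemma pd_logder i j x :
  pd i (logder j) x = pd i (pd j phi) x / phi x - logder i x * logder j x.
Proof.
have dpj : is_derive x 'e_i (pd j phi) (pd i (pd j phi) x).
  exact/smooth_is_derive/smooth_pd.
apply: etrans (is_derive_val (is_derive_mulf dpj
  (is_derive_invf (phi_derive i x) (phi_neq0 x)))) _.
rewrite /logder; have := phi_neq0 x.
by move: (phi x) (pd i phi x) (pd j phi x) (pd i _ x) => *; field.
Qed.

Lemma conformalE x i j : conformal phi x i j = dl i j * (phi x) ^- 2.
Proof. by rewrite /conformal /euclidean !mxE div1r mulrC. Qed.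

Lemma pd_conformal i j p x :
  pd i (fun y => conformal phi y j p) x =
  - 2 * dl j p * logder i x * (phi x) ^- 2.
Proof.
have dphi2 := is_derive_mulf (phi_derive i x) (phi_derive i x).
have phi2_neq0 : phi x * phi x != 0 by rewrite mulf_neq0.
have := is_derive_mulf (is_derive_cst (dl j p) x 'e_i) (is_derive_invf dphi2 phi2_neq0).
move=> /is_derive_val.
rewrite (_ : (fun y => _) = (fun y => conformal phi y j p)); last first.
  by apply/funext => y; rewrite conformalE expr2.
move=> dE; apply: etrans dE _; rewrite /logder; have := phi_neq0 x.
by move: (phi x) (pd i phi x) (dl j p) => * /=; field.
Qed.

Lemma christoffel_conformal k i j :
  christoffel (conformal phi) k i j =
  fun x => - (dl j k * logder i x + dl i k * logder j x - dl i j * logder k x).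
Proof.
apply/funext => x; rewrite /christoffel.
(* As a scalar matrix the metric has the explicit inverse phi^2 I, and the sum over [p] reduces to p
   = k. *)
have -> : conformal phi x = ((phi x) ^- 2)%:M.
  by rewrite /conformal /euclidean div1r scalemx1.
rewrite invmx_scalar invrK.
under eq_bigr => p _.
  rewrite mxE !pd_conformal -[_ *+ (k == p)]mulr_natl (eq_sym k p) -mulrA.
  over.
rewrite sum_delta; have := phi_neq0 x.
move: (phi x) (logder i x) (logder j x) (logder k x) => p vi vj vk p0.
by move: (dl j k) (dl i k) (dl i j) => *; field.
Qed.

Lemma pd_christoffel_conformal l k i j x :
  pd l (christoffel (conformal phi) k i j) x =
  - (dl j k * pd l (logder i) x + dl i k * pd l (logder j) x
     - dl i j * pd l (logder k) x).
Proof.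
rewrite christoffel_conformal; apply: is_derive_val; apply: is_derive_oppf.
have dc (c : R) m : is_derive x 'e_l (fun y => c * logder m y) (c * pd l (logder m) x).
  have := is_derive_mulf (is_derive_cst c x 'e_l) (logder_derive l m x).
  by rewrite mulr0 addr0.
exact: is_derive_addf (is_derive_addf (dc _ _) (dc _ _)) (is_derive_oppf (dc _ _)).
Qed.

Lemma sum_christoffel_conformal a b c d x :
  \sum_(q < n) christoffel (conformal phi) c a q x *
    christoffel (conformal phi) q b d x =
  dl d c * logder a x * logder b x + dl b c * logder a x * logder d x
  + 2 * dl a c * logder b x * logder d x - dl a d * logder b x * logder c x
  - dl a b * logder c x * logder d x
  - dl a c * dl b d * \sum_(q < n) logder q x ^+ 2.
Proof.
rewrite -(sum_connection_products (logder^~ x)).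
by apply: eq_bigr => q _; rewrite !christoffel_conformal.
Qed.

(** The tensor S of the overview, which is the Schouten tensor of phi^{-2} g. Its symmetry is not
    built in, as the entries contain ordered second derivatives. *)
Definition schouten x : 'M[R]_n :=
  \matrix_(i, j) (pd i (logder j) x + logder i x * logder j x
    - dl i j / 2 * \sum_(k < n) logder k x ^+ 2).

(** The last term is the exterior derivative of d ln phi. It is carried along rather than cancelled
    by symmetry of second derivatives; it disappears for c != d, or once S is known to be
    diagonal. *)
Lemma riemann_conformal x a b c d :
  riemann (conformal phi) x a b c d =
  (phi x) ^- 2 * (kulkarni_nomizu (schouten x) 1%:M a b c d
    - dl d c * (pd a (logder b) x - pd b (logder a) x)).
Proof.
rewrite /riemann.
under eq_bigr do rewrite conformalE (eq_sym c) -mulrA.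
rewrite sum_delta; congr (_ * _); rewrite /curvature_endo big_split/= sumrN.
rewrite !pd_christoffel_conformal !sum_christoffel_conformal.
have oneE i j : (1%:M : 'M[R]_n) i j = dl i j by rewrite mxE.
rewrite /kulkarni_nomizu !oneE ![schouten x _ _]mxE.
rewrite (eq_sym b a).
move: (\sum_(k < n) logder k x ^+ 2) => N.
move: (logder a x) (logder b x) (logder c x) (logder d x) => va vb vc vd.
move: (dl d c) (dl b c) (dl b d) (dl a c) (dl a d) (dl a b) => dc bc bd ac ad ab.
generalize (pd a (logder b) x) (pd a (logder c) x) (pd a (logder d) x)
  (pd b (logder a) x) (pd b (logder c) x) (pd b (logder d) x) => *.
by field.
Qed.

Lemma schoutenE x i j : schouten x i j =
  pd i (pd j phi) x / phi x - dl i j / 2 * \sum_(k < n) logder k x ^+ 2.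
Proof. by rewrite mxE pd_logder subrK. Qed.

(** With three distinct indices available, S can be recovered from its Kulkarni-Nomizu product with
    g: off-diagonal entries from single components, diagonal ones from the pairwise sums S_aa +
    S_bb. *)
Lemma riemann_conformal_diag (hn : (3 <= n)%N) (f : 'I_n -> E -> R) x :
  (forall a b c d, riemann (conformal phi) x a b c d =
     kulkarni_nomizu (diag_tensor f x) (euclidean x) a b c d) <->
  (forall i j, schouten x i j = dl i j * (phi x ^+ 2 * f i x)).
Proof.
have diagE i j : diag_tensor f x i j = dl i j * f i x.
  by rewrite /diag_tensor !mxE mulr_natl.
split=> [Rf|Sf a b c d]; last first.
  (* S_ij = 0 off the diagonal reads v_{j,i} = - v_i v_j, whose right-hand side is symmetric. *)
  have sym : pd a (logder b) x = pd b (logder a) x.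
    have [->//|ab] := eqVneq a b.
    have off i j : i != j -> pd i (logder j) x = - (logder i x * logder j x).
      move=> ij; apply/eqP; rewrite -addr_eq0; apply/eqP; have := Sf i j.
      by rewrite mxE (negPf ij) !mul0r subr0.
    apply: etrans (off a b ab) _; apply: esym; apply: etrans (off b a _) _.
      by rewrite eq_sym.
    by rewrite mulrC.
  rewrite riemann_conformal sym subrr mulr0 subr0 /kulkarni_nomizu !Sf !diagE.
  by rewrite /euclidean; field.
(* This is where n >= 3 enters. *)
have third (a b : 'I_n) : exists c, (c != a) && (c != b).
  have : (0 < #|~: [set a; b]|)%N.
    rewrite cardsCs finset.setCK card_ord subn_gt0 (leq_ltn_trans _ hn)// cards2.
    by case: (_ == _).
  by case/card_gt0P => c; rewrite !inE negb_or => cab; exists c.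
have RfE a b c d : d != c -> kulkarni_nomizu (schouten x) 1%:M a b c d =
    phi x ^+ 2 * kulkarni_nomizu (diag_tensor f x) 1%:M a b c d.
  move=> /negPf dc; rewrite -Rf riemann_conformal dc mul0r subr0.
  by rewrite mulVKf// expf_neq0.
have oneE i j : (1%:M : 'M[R]_n) i j = dl i j by rewrite mxE.
pose simp := (mul0r, mulr0, mulr1, mul1r, subr0, add0r, addr0, sub0r, oppr0).
(* The component (a, b, a, b). *)
have pairs a b : a != b ->
    schouten x a a + schouten x b b = phi x ^+ 2 * (f a x + f b x).
  rewrite eq_sym => ba; have := RfE a b a b ba; rewrite eq_sym in ba.
  rewrite /kulkarni_nomizu !diagE !oneE !eqxx (eq_sym b a) (negPf ba).
  by rewrite !simp.
move=> i j; have [<-|ij] := eqVneq i j.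
  (* The three pairwise sums over [i], [p], [q] determine S_ii. *)
  have [p /andP[pi _]] := third i i; have [q /andP[qi qp]] := third i p.
  have := pairs _ _ pi; have := pairs _ _ qi; have := pairs _ _ qp.
  rewrite mul1r !mulrDr.
  move: (schouten x i i) (schouten x p p) (schouten x q q) => Si Sp Sq.
  move: (phi x ^+ 2 * f i x) (phi x ^+ 2 * f p x) (phi x ^+ 2 * f q x) => Fi Fp Fq.
  by lra.
(* The component (i, b, b, j) of the product is - S_ij, while that of T kn g is zero. *)
have [b /andP[/negPf bi]] := third i j; rewrite eq_sym => bj.
have := RfE i b b j bj; rewrite /kulkarni_nomizu !diagE !oneE eqxx.
rewrite (eq_sym i b) bi (negPf ij) (eq_sym b j) (negPf bj) !simp => /eqP.
by rewrite oppr_eq0 => /eqP.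
Qed.

End ConformalCurvature.

(** * From the curvature equation to the differential system and back *)

Section ConformalSystem.
Context {R : realType} {n : nat}.
Local Notation E := ('rV[R]_n).
Local Notation dl i j := ((i == j)%:R : R).
Implicit Types (f h : 'I_n -> E -> R) (phi P psi : E -> R) (i j k : 'I_n) (x : E).

Lemma quo_conformal_solution f phi : (3 <= n)%N -> (forall i, smooth (f i)) ->
  (forall i j, i != j -> forall x, 3 * f i x + f j x != 0) ->
  conformal_solution f phi ->
  forall i j, i != j -> forall x, quo f i j x = - logder phi j x.
Proof.
move=> hn fS f0 [phiS phi_gt0 Rf] i j ij x.
have phi_neq0 y : phi y != 0 by rewrite gt_eqF.
have Sf y a b : schouten phi y a b = dl a b * (phi y ^+ 2 * f a y).
  exact: (riemann_conformal_diag phiS phi_gt0 hn f y).1 (Rf y) a b.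
have off a b : a != b -> forall y, pd a (pd b phi) y = 0.
  move=> ab y; have := Sf y a b; rewrite schoutenE// (negPf ab) !mul0r subr0.
  by move=> /eqP; rewrite mulf_eq0 invr_eq0 (negPf (phi_neq0 y)) orbF => /eqP.
pose q k y := pd k phi y.
(* The diagonal equation multiplied by phi^2, a form without quotients to differentiate. *)
have diag a y : phi y * pd a (q a) y =
    phi y * phi y * (phi y * phi y) * f a y + 2^-1 * \sum_(k < n) q k y * q k y.
  have := Sf y a a; rewrite schoutenE// eqxx !mul1r /logder.
  under eq_bigr do rewrite expr_div_n expr2 mulrC.
  rewrite -mulr_sumr -/(q a); have := phi_neq0 y.
  under eq_bigr do rewrite -/(q _ y).
  move: (phi y) (pd a (q a) y) (\sum_(k < n) _) (f a y) => p paa N fa p0 e.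
  have -> : paa = p * (p ^+ 2 * fa + 2^-1 * (p ^- 2 * N)) by rewrite -e; field.
  by field.
have qS k : smooth (q k) by exact: smooth_pd.
have dq k := smooth_is_derive j x (qS k).
have dphi : is_derive x 'e_j phi (q j x) := smooth_is_derive j x phiS.
have df := smooth_is_derive j x (fS i).
(* Since phi_{,ij} = 0, the function phi_{,i} is constant along e_j, and so is phi_{,ii}. *)
have dqi : is_derive x 'e_j (pd i (q i)) 0.
  have <- : pd j (pd i (q i)) x = 0.
    by apply: (pd_pd_eq0 i (qS i)); apply: off; rewrite eq_sym.
  exact: smooth_is_derive j x (smooth_pd i (qS i)).
have dL := is_derive_mulf dphi dqi.
have dphi2 := is_derive_mulf dphi dphi.
have dR := is_derive_addf (is_derive_mulf (is_derive_mulf dphi2 dphi2) df)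
  (is_derive_mulf (is_derive_cst (2^-1 : R) x 'e_j)
     (is_derive_sumf (fun k => is_derive_mulf (dq k) (dq k)))).
have := etrans (esym (is_derive_val dL))
  (etrans (congr1 (fun F => 'D_'e_j F x) (funext (diag i))) (is_derive_val dR)).
rewrite /=.
(* Along e_j only the summand k = j of |grad phi|^2 varies, the mixed derivatives being zero. *)
rewrite (bigD1 j)//= big1 ?addr0; last first.
  by move=> k kj; rewrite /q off 1?eq_sym// mulr0 addr0.
have := diag i x; have := diag j x.
rewrite /quo /logder -/(q j x); have := f0 _ _ ij x; have := phi_neq0 x.
move: (\sum_(k < n) _) => N.
move: (pd j (f i) x) (pd i (q i) x) (pd j (q j) x) => fij qii qjj.
move: (q j x) (phi x) (f i x) (f j x) => qj p fi fj p0 nd Ej Ei Dij.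
(* Subtracting the diagonal equations for [i] and [j] eliminates the gradient term [N]. *)
have qiiE : qii = qjj + p ^+ 3 * (fi - fj).
  by apply: (mulfI p0); rewrite Ei mulrDr Ej; ring.
apply/eqP; rewrite -mulNr eqr_div//; apply/eqP.
apply: (mulfI (expf_neq0 3 p0)); move: Dij; rewrite qiiE => Dij.
(* The terms in [qjj] cancel and leave - p^3 qj (3 fi + fj), which produces the denominator of
   [quo]. *)
have e : p ^+ 4 * fij = (qjj + p ^+ 3 * (fi - fj)) * qj - 4 * p ^+ 3 * qj * fi - qjj * qj.
  by lra.
have -> : p ^+ 3 * (fij * p) = p ^+ 4 * fij by ring.
by rewrite e; ring.
Qed.

Lemma pde_systemP f h phi (m l : 'I_n) : l != m ->
  smooth phi -> (forall x, 0 < phi x) ->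
  (forall i j, i != j -> forall x, quo f i j x = - logder phi j x) ->
  (forall i x, h i x = f i x * phi x ^+ 2) ->
  pde_system f h <->
  (forall x i j, schouten phi x i j = dl i j * (phi x ^+ 2 * f i x)).
Proof.
move=> lm phiS phi_gt0 quoE hE.
have pd_quo a i j : i != j -> forall x, pd a (quo f i j) x = - pd a (logder phi j) x.
  move=> ij x; rewrite (_ : quo f i j = fun y => - logder phi j y); last first.
    by apply/funext => y; exact: quoE.
  apply: is_derive_val; apply: is_derive_oppf.
  exact/smooth_is_derive/smooth_logder.
(* Splitting off k = i turns v_i^2 - |v|^2 / 2 into the two quadratic terms of (4). *)
have sumE i x : \sum_(k < n) logder phi k x ^+ 2 =
    logder phi i x ^+ 2 + \sum_(k < n | k != i) logder phi k x ^+ 2.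
  by rewrite (bigD1 i).
(* A concrete choice of l(k) != k at which (4) is instantiated; [ell i] also serves as its index
   [j]. *)
pose ell k := if k == m then l else m.
have ellP k : ell k != k.
  by rewrite /ell; case: (eqVneq k m) => [->//|]; rewrite eq_sym.
have sum_quo x i e : (forall k, e k != k) ->
    \sum_(k < n | k != i) quo f (e k) k x ^+ 2 =
    \sum_(k < n | k != i) logder phi k x ^+ 2.
  by move=> eP; apply: eq_bigr => k _; rewrite quoE// sqrrN.
split=> [[_ _ _ sys4 sys5] x i j|Sf].
  rewrite mxE; have [<-|ij] := eqVneq i j.
    have := sys4 ell ellP i (ell i); rewrite eq_sym => /(_ (ellP i) x).
    rewrite sum_quo// pd_quo// quoE// hE (sumE i) !mul1r.
    move: (\sum_(k < n | _) _) => N; generalize (pd i (logder phi i) x) => H.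
    by move: (logder phi i x) (f i x) (phi x) => v fi p; lra.
  have := sys5 i j ij x; rewrite pd_quo// !quoE// 1?eq_sym// mulrNN => ->.
  by rewrite !mul0r subr0 subrr.
have off i j x : i != j -> pd i (logder phi j) x = - (logder phi i x * logder phi j x).
  move=> ij; apply/eqP; rewrite -addr_eq0; apply/eqP; have := Sf x i j.
  by rewrite mxE (negPf ij) !mul0r subr0.
(* The symmetry behind (2) and (3) comes from the off-diagonal equations. *)
have sym i j x : pd i (logder phi j) x = pd j (logder phi i) x.
  have [->//|ij] := eqVneq i j.
  apply: etrans (off i j x ij) _; apply: esym; apply: etrans (off j i x _) _.
    by rewrite eq_sym.
  by rewrite mulrC.
split.
- by move=> i j k ij kj x; rewrite !quoE.
- move=> i j k ij kj x; rewrite eq_sym in ij; rewrite eq_sym in kj.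
  exact: etrans (pd_quo k j i ij x)
    (etrans (congr1 -%R (sym k i x)) (esym (pd_quo i j k kj x))).
- move=> i j ij x; have ji : j != i by rewrite eq_sym.
  exact: etrans (pd_quo i i j ij x)
    (etrans (congr1 -%R (sym i j x)) (esym (pd_quo j j i ji x))).
- move=> e eP i j ij x; have ji : j != i by rewrite eq_sym.
  rewrite (sum_quo _ _ _ eP) (pd_quo i j i ji) (quoE _ _ ji) hE.
  have := Sf x i i; rewrite mxE (sumE i) eqxx !mul1r.
  move: (\sum_(k < n | _) _) => N; generalize (pd i (logder phi i) x) => H.
  by move: (logder phi i x) (f i x) (phi x) => v fi p; lra.
- move=> i j ij x; have ji : j != i by rewrite eq_sym.
  rewrite (pd_quo i i j ij) (quoE _ _ ij) (quoE _ _ ji).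
  by rewrite (off i j x ij) mulrNN opprK.
Qed.

Lemma smooth_phi_of P psi : smooth P -> smooth psi -> smooth (phi_of P psi).
Proof.
move=> PS psiS; apply: smooth_closure_smooth; apply: SmoothExp.
by apply: SmoothAdd; [apply: SmoothOpp|]; apply: SmoothBase.
Qed.

Lemma logder_phi_of P psi i x : smooth P -> smooth psi ->
  logder (phi_of P psi) i x = - pd i P x + pd i psi x.
Proof.
move=> PS psiS; rewrite /logder.
have dP := is_derive_oppf (smooth_is_derive i x PS).
have := is_derive_comp1 (is_derive_addf dP (smooth_is_derive i x psiS))
  (is_derive_expR _).
move=> /is_derive_val dE; rewrite [pd i (phi_of _ _) x]dE.
by rewrite mulrC mulKf// gt_eqF// expR_gt0.
Qed.

(** Along x_m only [P] contributes, because [psi] is independent of x_m; along every other axis the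
    derivatives of [P] cancel. Thus the conditions on [psi] alone fix the logarithmic gradient. *)
Lemma logder_psi_condition f m l P psi : smooth P ->
  (forall x, pd m P x = quo f l m x) -> psi_condition f m P psi ->
  forall j x, logder (phi_of P psi) j x = - quo f (if j == m then l else m) j x.
Proof.
move=> PS dP [psiS psim dpsi] j x; rewrite logder_phi_of//.
case: (eqVneq j m) => [->|jm].
  by rewrite dP (depends_not_on_pd x psim) addr0.
by rewrite dpsi// addrA addNr add0r.
Qed.

Lemma h_ofE f P psi i x : h_of f P psi i x = f i x * phi_of P psi x ^+ 2.
Proof. by rewrite /h_of /phi_of -expRM_natl. Qed.

Lemma is_derive_ln_comp phi i x : smooth phi -> (forall y, 0 < phi y) ->
  is_derive x 'e_i (fun y => ln (phi y)) (logder phi i x).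
Proof.
move=> phiS phi_gt0; rewrite /logder mulrC.
by apply: is_derive_comp1; [exact: smooth_is_derive|exact: is_derive1_ln].
Qed.

End ConformalSystem.

(** * The equivalence, the formula for phi and its uniqueness up to a factor *)

Theorem theorem3p2 (R : realType) (n : nat) (hn : (3 <= n)%N)
  (f : 'I_n -> 'rV[R]_n -> R)
  (f_smooth : forall i, smooth (f i))
  (f_nondeg : forall i j, i != j -> forall x, 3 * f i x + f j x != 0)
  (m l : 'I_n) (hlm : l != m)
  (P : 'rV[R]_n -> R) (P_smooth : smooth P)
  (P_prim : forall x, pd m P x = quo f l m x) :
  ((exists phi, conformal_solution f phi) <->
   (exists psi, psi_condition f m P psi /\ pde_system f (h_of f P psi)))
  /\
  (forall psi, psi_condition f m P psi ->
     (pde_system f (h_of f P psi) -> conformal_solution f (phi_of P psi)) /\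
     (forall phi, conformal_solution f phi ->
        exists2 c : R, 0 < c & forall x, phi x = c * phi_of P psi x)).
Proof.
have phi_of_gt0 psi x : 0 < phi_of P psi x by exact: expR_gt0.
have sufficiency psi : psi_condition f m P psi -> pde_system f (h_of f P psi) ->
    conformal_solution f (phi_of P psi).
  move=> psiC sys; have [psiS _ _] := psiC.
  have phiS := smooth_phi_of P_smooth psiS.
  have quoE i j : i != j -> forall x, quo f i j x = - logder (phi_of P psi) j x.
    move=> ij x; rewrite (logder_psi_condition P_smooth P_prim psiC) opprK.
    case: sys => sys1 _ _ _ _; apply: sys1 => //.
    by case: (eqVneq j m) => [->//|]; rewrite eq_sym.
  have hE := h_ofE f P psi.
  have [Sf _] := pde_systemP hlm phiS (phi_of_gt0 psi) quoE hE.
  split=> // x; apply: (riemann_conformal_diag phiS (phi_of_gt0 psi) hn f x).2.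
  exact: Sf.
split; last first.
  move=> psi psiC; split; first exact: sufficiency.
  move=> phi phiC; have [psiS psim dpsi] := psiC; have [phiS phi_gt0 _] := phiC.
  have phi_quo := quo_conformal_solution hn f_smooth f_nondeg phiC.
  (* The logarithm of phi / [phi_of P psi]. Both functions have the same logarithmic gradient, so
     [F] is constant and exp of its value at 0 is the factor. *)
  pose F x := ln (phi x) + - (- P x + psi x).
  have FS : smooth F.
    apply: smooth_closure_smooth; apply: SmoothAdd.
      by apply: SmoothLn => //; apply: SmoothBase.
    apply: SmoothOpp; apply: SmoothAdd; last exact: SmoothBase.
    exact/SmoothOpp/SmoothBase.
  have dF i x : pd i F x = 0.
    have dP := is_derive_oppf (smooth_is_derive i x P_smooth).
    have dA := is_derive_addf dP (smooth_is_derive i x psiS).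
    apply: etrans (is_derive_val (is_derive_addf
      (is_derive_ln_comp i x phiS phi_gt0) (is_derive_oppf dA))) _.
    rewrite -logder_phi_of// (logder_psi_condition P_smooth P_prim psiC) opprK.
    rewrite phi_quo ?subrr//.
    by case: (eqVneq i m) => [->//|]; rewrite eq_sym.
  exists (expR (F 0)); first exact: expR_gt0.
  move=> x; rewrite (pd_eq0_cst FS dF 0 x) /phi_of -expRD subrK lnK//.
  exact: phi_gt0.
split=> [[phi phiC]|[psi [psiC sys]]]; last by exists (phi_of P psi); exact: sufficiency.
have [phiS phi_gt0 Rf] := phiC.
have phi_quo := quo_conformal_solution hn f_smooth f_nondeg phiC.
pose psi x := P x + ln (phi x).
have psiS : smooth psi.
  apply: smooth_closure_smooth; apply: SmoothAdd; first exact: SmoothBase.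
  by apply: SmoothLn => //; apply: SmoothBase.
have dpsi i x : pd i psi x = pd i P x + logder phi i x.
  exact: is_derive_val (is_derive_addf (smooth_is_derive i x P_smooth)
    (is_derive_ln_comp i x phiS phi_gt0)).
have phiE x : phi_of P psi x = phi x.
  by rewrite /phi_of /psi addrA addNr add0r lnK// posrE.
exists psi; split.
  split=> // [|i im x]; last by rewrite dpsi phi_quo ?opprK// eq_sym.
  (* Along x_m the integrand of [P] cancels against v_m. *)
  apply: pd_eq0_depends_not_on => // x.
  by rewrite dpsi P_prim phi_quo// addNr.
have hE i x : h_of f P psi i x = f i x * phi x ^+ 2 by rewrite h_ofE phiE.
apply/(pde_systemP hlm phiS phi_gt0 phi_quo hE) => x.
exact: (riemann_conformal_diag phiS phi_gt0 hn f x).1.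
Qed.
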